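(* Suppose that: (i) for each $\pi\in\mathbb{S}$, $V\in\mathbb{R}^d$, $P\in\mathbb{S}^d$ and each index $1\le i\le d$, the mapping $q\mapsto e_i(\pi,\mathcal{P}(P,q,i),V)$, $q\in\mathbb{S}$, is convex; (ii) for all $i$ the map $P\mapsto e_i(\pi,P,V)$ is continuous; and (iii) for all $\pi\in\mathbb{S}$ and $V\in\mathbb{R}^d$ the function $g$ given by $g_{ij}(P)=\frac{\partial e_i(\pi,P,V)}{\partial P_{ij}}$ is diagonally convex. Then for every $\pi\in\mathbb{S}$ and $V\in\mathbb{R}^d$ there exists a unique transition matrix $P\in\mathbb{S}^d$ which is a Nash minimizer of $e(\pi,\cdot,V)$.
   Context: Let $d>1$ be an integer and $\mathbb{S}=\{(q_1,\dots,q_d): q_j\ge 0\ \forall j,\ \sum_{j=1}^d q_j=1\}$. The set of $d\times d$ (row-)stochastic (transition) matrices is identified with $\mathbb{S}^d$. Given transition costs $c_{ij}(\pi,P)$, $1\le i,j\le d$, define $e_i(\pi,P,V)=\sum_j \left(c_{ij}(\pi,P)P_{ij}+V_jP_{ij}\right)$ for $\pi\in\mathbb{S}$, $V\in\mathbb{R}^d$; the functions $e_i(\pi,\cdot,V)$ are assumed to be defined and differentiable in the matrix variable $P\in\mathbb{R}^{d\times d}$. For $P\in\mathbb{S}^d$, $q\in\mathbb{S}$, $\mathcal{P}(P,q,i)$ is the stochastic matrix obtained from $P$ by replacing its $i$-th row by $q$ and leaving all other rows unchanged. A matrix $P\in\mathbb{S}^d$ is a Nash minimizer of $e(\pi,\cdot,V)$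 if for each $i$ and any $q\in\mathbb{S}$, $e_i(\pi,P,V)\le e_i(\pi,\mathcal{P}(P,q,i),V)$. A function $g:\mathbb{R}^{d\times d}\to\mathbb{R}^{d\times d}$ is diagonally convex if for all $P^1\ne P^2$ in $\mathbb{R}^{d\times d}$, $\sum_{ij}(P^1_{ij}-P^2_{ij})(g_{ij}(P^1)-g_{ij}(P^2))>0$. *)

(* Defs.v *)
From mathcomp Require Export all_boot all_order all_algebra.
From mathcomp Require Export all_classical all_reals all_analysis.
Export Order.TTheory GRing.Theory Num.Theory.
Export numFieldNormedType.Exports.

Set Implicit Arguments.
Unset Strict Implicit.
Unset Printing Implicit Defensive.

Local Open Scope classical_set_scope.
Local Open Scope ring_scope.

Section Defs.
Context {R : realType} {d : nat}.
Implicit Types (P : 'M[R]_d) (q pi V : 'rV[R]_d) (i j : 'I_d).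

Definition prob_simplex : set 'rV[R]_d :=
  [set q | (forall j, 0 <= q ord0 j) /\ \sum_j q ord0 j = 1].

Definition stochastic_mx : set 'M[R]_d :=
  [set P | forall i, prob_simplex (row i P)].

Definition replace_row P q i : 'M[R]_d :=
  \matrix_(k, l) if k == i then q ord0 l else P k l.

(* The costs are total functions on the ambient spaces; only arguments pi in
   the simplex are ever constrained or used. *)
Definition expected_cost (c : 'I_d -> 'I_d -> 'rV[R]_d -> 'M[R]_d -> R)
    i pi P V : R :=
  \sum_j (c i j pi P * P i j + V ord0 j * P i j).

Definition nash_minimizer (f : 'I_d -> 'M[R]_d -> R) P : Prop :=
  stochastic_mx P /\
  forall i q, prob_simplex q -> f i P <= f i (replace_row P q i).

Definition diagonally_convex (g : 'M[R]_d -> 'M[R]_d) : Prop :=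
  forall P1 P2, P1 != P2 ->
    0 < \sum_i \sum_j (P1 i j - P2 i j) * (g P1 i j - g P2 i j).

(* The (i, j) entry is the partial derivative of the i-th function with respect
   to the (i, j) entry of its argument: each function is differentiated only
   along its own row. *)
Definition own_row_gradient (f : 'I_d -> 'M[R]_d -> R) P : 'M[R]_d :=
  \matrix_(i, j) 'D_(delta_mx i j) (f i) P.

End Defs.

(* Main.v *)
Require Import Defs.
From mathcomp Require Import ring lra.

(* The own-row gradient [g] is strictly monotone.  Minty's variational inequality
   [<g Q, Q - P> >= 0] for all stochastic [Q] has a solution [P]: for finitely
   many [Q] it is a matrix problem [A lam >= 0] with [A + A^T >= 0], and
   compactness does the rest, so no fixed point theorem is needed.  Testing it
   along the segment that changes only row [i] of [P] shows that [e_i] increases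
   along that segment, so [P] is a Nash minimizer.  Conversely two Nash minimizers
   satisfy each other's first-order condition, against strict monotonicity. *)

Local Open Scope classical_set_scope.
Local Open Scope ring_scope.

(** * The probability simplex *)

Lemma continuous_sum {R : realType} {T : topologicalType} {I : finType}
    (F : I -> T -> R) :
  (forall i, continuous (F i)) -> continuous (fun x => \sum_i F i x).
Proof.
by move=> cF; apply: continuous_big => // x; exact: add_continuous.
Qed.

Lemma prob_simplex_compact (R : realType) (n : nat) :
  compact (@prob_simplex R n).
Proof.
apply: (@subclosed_compact _ _
    [set v : 'rV[R]_n | forall i, `[0, 1]%classic (v ord0 i)]); last 2 first.
- apply: (@rV_compact R n (fun=> `[0, 1]%classic)) => i; exact: segment_compact.
- move=> v [v0 v1] i /=; rewrite in_itv /= v0 -v1 (bigD1 i) //= lerDl.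
  by rewrite sumr_ge0.
- have -> : @prob_simplex R n =
      \bigcap_(i in [set: 'I_n]) [set v : 'rV[R]_n | 0 <= v ord0 i] `&`
      (fun v : 'rV[R]_n => \sum_j v ord0 j) @^-1` [set 1].
    by apply/seteqP; split=> v /= [v0 v1]; split=> // i; [move=> _|]; exact: v0.
  apply: closedI.
  + apply: closed_bigI => i _.
    apply: (@preimage_closed _ _ (fun v : 'rV[R]_n => v ord0 i) [set x | 0 <= x]);
      last exact: closed_ge.
    by move=> v _; exact: coord_continuous.
  + apply: preimage_closed; last exact: closed_eq.
    by move=> v _; apply: continuous_sum => j; exact: coord_continuous.
Qed.

Lemma delta_prob_simplex {R : realType} {n : nat} (k : 'I_n) :
  prob_simplex (delta_mx ord0 k : 'rV[R]_n).
Proof.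
split=> [j|]; first by rewrite mxE ler0n.
rewrite (bigD1 k) //= mxE !eqxx big1 ?addr0 // => j /negbTE jk.
by rewrite mxE jk andbF.
Qed.

Lemma segment_prob_simplex {R : realType} {n : nat} (p q : 'rV[R]_n) (t : R) :
  prob_simplex p -> prob_simplex q -> 0 <= t <= 1 ->
  prob_simplex (p + t *: (q - p)).
Proof.
move=> [p0 p1] [q0 q1] /andP[t0 t1]; split=> [j|].
  by rewrite !mxE; have := p0 j; have := q0 j; nra.
under eq_bigr do rewrite !mxE mulrBr.
by rewrite big_split sumrB /= -!mulr_sumr p1 q1; lra.
Qed.

(** * A matrix inequality solved by a probability vector *)

(** Instead of dividing by [t] and letting it tend to 0, one value suffices: if [0 < a], then
    [t = a / (a + b)] satisfies [t * b = a - t * a < 2 * a]. *)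
Lemma le0_of_quadratic_bound {R : realFieldType} {a b : R} :
  0 <= b -> (forall t, 0 < t <= 1 -> 2 * t * a <= t ^+ 2 * b) -> a <= 0.
Proof.
move=> b0 H; rewrite leNgt; apply/negP => a0.
have ab : 0 < a + b by lra.
have t0 : 0 < a / (a + b) by rewrite divr_gt0.
have t1 : a / (a + b) <= 1 by rewrite ler_pdivrMr //; lra.
have := H (a / (a + b)); rewrite t0 t1 => /(_ isT).
have e : a / (a + b) * (a + b) = a by rewrite divfK // gt_eqF.
by move: (a / (a + b)) t0 t1 e => t t0 t1 e; nra.
Qed.

(* A weight minimising the squared norm of the negative part of [A lam] works:
   if that negative part [u] were nonzero, stationarity would make every entry
   of [u A] negative, against [u A u^T >= 0]. *)
Lemma prob_simplex_mulmx_ge0 {R : realType} {n : nat} (A : 'M[R]_n.+1) :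
  (forall k l, 0 <= A k l + A l k) ->
  exists2 lam : 'rV[R]_n.+1,
    prob_simplex lam & forall k, 0 <= \sum_l A k l * lam ord0 l.
Proof.
move=> A0.
pose y (lam : 'rV[R]_n.+1) k := \sum_l A k l * lam ord0 l.
pose neg (x : R) := Num.max 0 (- x).
pose F lam := \sum_k neg (y lam k) ^+ 2.
(* [neg x] is the distance from [x] to the nonnegative half-line. *)
have negE x z : 0 <= z -> neg x ^+ 2 <= (x - z) ^+ 2.
  rewrite /neg /Num.max; case: ltP => [x0 z0|_ _]; last by rewrite expr0n sqr_ge0.
  by rewrite -subr_ge0 (_ : _ - _ = z * (z + 2 * - x)); [apply: mulr_ge0; lra|ring].
have neg_ge0 x : 0 <= neg x by rewrite /neg le_max lexx.
have negpos x : 0 <= x + neg x by rewrite /neg /Num.max; case: ifP; lra.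
have negM x : neg x * x = - neg x ^+ 2.
  by rewrite /neg /Num.max; case: ifP => _; ring.
have cF : continuous F.
  apply: continuous_sum => k lam.
  have cn : {for lam, continuous (fun v => neg (y v k))}.
    apply: (@continuous_max R _ (cst 0)); first exact: cst_continuous.
    apply: continuousN; apply: continuous_sum => l v.
    by apply: continuousM; [exact: cst_continuous|exact: coord_continuous].
  exact: (@continuousM R _ _ _ lam cn cn).
have [lam] := @compact_EVT_min _ R F (@prob_simplex R n.+1)
  (ex_intro _ _ (delta_prob_simplex ord0)) (@prob_simplex_compact R n.+1)
  (continuous_subspaceT cF).
rewrite inE => lamS lam_min; exists lam => // k; rewrite leNgt.
apply/negP => yk0.
pose u k := neg (y lam k).
pose s := \sum_k u k ^+ 2.
have stationary l : \sum_k u k * A k l <= - s.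
  (* [b] is the velocity of [y] as [lam] moves straight towards the vertex [l]. The bound on [b]
     gives the one on [A] because [u k * y lam k = - u k ^+ 2]. *)
  pose b k := A k l - y lam k.
  suff: \sum_k u k * b k <= 0.
    rewrite /b /s; under eq_bigr do rewrite mulrBr /u negM.
    by rewrite sumrB sumrN opprK -/s; lra.
  have B0 : 0 <= \sum_k b k ^+ 2 by apply: sumr_ge0 => i _; exact: sqr_ge0.
  apply: (le0_of_quadratic_bound B0) => t t01.
  pose mu := lam + t *: (delta_mx ord0 l - lam).
  have muS : prob_simplex mu.
    apply: segment_prob_simplex => //; first exact: delta_prob_simplex.
    by lra.
  have ymu i : y mu i = y lam i + t * b i.
    rewrite /y /b /mu; under eq_bigr do rewrite !mxE mulrDr mulrCA mulrBr.
    rewrite big_split /= -mulr_sumr sumrB; congr (_ + _ * (_ - _)).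
    rewrite (bigD1 l) //= !eqxx mulr1 big1 ?addr0 // => j /negbTE jl.
    by rewrite jl mulr0.
  have := lam_min mu; rewrite inE => /(_ muS) Fle.
  (* [negE] is applied with [z] the positive part [y lam i + u i] of [y lam i], which bounds each
     term by [(t * b i - u i) ^+ 2]. *)
  have : F mu <= s - 2 * t * (\sum_k u k * b k) + t ^+ 2 * \sum_k b k ^+ 2.
    rewrite !mulr_sumr -sumrB -big_split /=; apply: ler_sum => i _.
    apply: (le_trans (negE _ _ (negpos (y lam i)))).
    by rewrite ymu le_eqVlt; apply/orP; left; apply/eqP; rewrite /u; ring.
  move=> /(le_trans Fle); rewrite -[F lam]/s.
  by rewrite -addrA lerDl addrC subr_ge0.
have uk0 : 0 < u k by rewrite /u /neg lt_max; apply/orP; right; rewrite oppr_gt0.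
have su0 : 0 < \sum_k u k.
  by rewrite (bigD1 k) //= ltr_pwDl // sumr_ge0 // => i _; exact: neg_ge0.
have s0 : 0 < s.
  rewrite /s (bigD1 k) //= ltr_pwDl ?exprn_gt0 // sumr_ge0 // => i _.
  exact: sqr_ge0.
(* Doubling the form symmetrises it, so that only the sums [A i j + A j i] occur. *)
have form_ge0 : 0 <= \sum_l u l * \sum_k u k * A k l.
  rewrite -(pmulrn_lge0 _ (isT : (0 < 2)%N)) mulr2n.
  under eq_bigr do rewrite mulr_sumr.
  rewrite {1}exchange_big /= -big_split /=; apply: sumr_ge0 => i _.
  rewrite -big_split /=; apply: sumr_ge0 => j _.
  rewrite (_ : _ + _ = u i * u j * (A i j + A j i)); last by ring.
  by rewrite mulr_ge0 // mulr_ge0 // neg_ge0.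
have : \sum_l u l * \sum_k u k * A k l <= \sum_l u l * - s.
  by apply: ler_sum => i _; apply: ler_wpM2l => //; exact: neg_ge0.
by rewrite -mulr_suml; nra.
Qed.

(** * The Frobenius inner product *)

Definition mxdot {R : realType} {m n : nat} (A B : 'M[R]_(m, n)) : R :=
  \sum_i \sum_j A i j * B i j.

Section Mxdot.
Context {R : realType} {m n : nat}.
Implicit Types A B C : 'M[R]_(m, n).

Lemma mxdotC A B : mxdot A B = mxdot B A.
Proof. by apply: eq_bigr => i _; apply: eq_bigr => j _; rewrite mulrC. Qed.

Lemma mxdotBr A B C : mxdot A (B - C) = mxdot A B - mxdot A C.
Proof.
rewrite /mxdot -sumrB; apply: eq_bigr => i _; rewrite -sumrB.
by apply: eq_bigr => j _; rewrite !mxE mulrBr.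
Qed.

Lemma mxdotBl A B C : mxdot (A - B) C = mxdot A C - mxdot B C.
Proof. by rewrite mxdotC mxdotBr !(mxdotC C). Qed.

Lemma mxdotZr A B (a : R) : mxdot A (a *: B) = a * mxdot A B.
Proof.
rewrite mulr_sumr; apply: eq_bigr => i _; rewrite mulr_sumr.
by apply: eq_bigr => j _; rewrite !mxE mulrCA.
Qed.

Lemma mxdotNr A B : mxdot A (- B) = - mxdot A B.
Proof. by rewrite -scaleN1r mxdotZr mulN1r. Qed.

Lemma mxdot_sumr (I : finType) A (F : I -> 'M[R]_(m, n)) :
  mxdot A (\sum_k F k) = \sum_k mxdot A (F k).
Proof.
rewrite [RHS]exchange_big; apply: eq_bigr => i _ /=.
rewrite exchange_big; apply: eq_bigr => j _ /=.
by rewrite summxE mulr_sumr.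
Qed.

Lemma mxdot_continuous A : continuous (mxdot A).
Proof.
apply: continuous_sum => i; apply: continuous_sum => j B.
by apply: continuousM; [exact: cst_continuous|exact: coord_continuous].
Qed.

End Mxdot.

(** * Minty's variational inequality for a monotone map *)

(** Each [Q] confines [P] to a closed half-space, so by the finite intersection property on [K] it
    suffices to satisfy finitely many constraints at once. A convex combination of the finitely many
    [Q] does this. *)
Lemma monotone_variational_inequality {R : realType} {m n : nat}
    (K : set 'M[R]_(m, n)) (g : 'M[R]_(m, n) -> 'M[R]_(m, n)) :
  compact K -> K !=set0 ->
  (forall k (lam : 'rV[R]_k) (Q : 'I_k -> 'M[R]_(m, n)),
     prob_simplex lam -> (forall i, K (Q i)) ->
     K (\sum_i lam ord0 i *: Q i)) ->
  (forall P Q, 0 <= mxdot (g P - g Q) (P - Q)) ->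
  exists2 P, K P & forall Q, K Q -> 0 <= mxdot (g Q) (Q - P).
Proof.
move=> Kcompact [P0 KP0] Kconvex g_monotone.
pose halfspace Q := [set P | mxdot (g Q) P <= mxdot (g Q) Q].
suff : \bigcap_(Q in K) (K `&` halfspace Q) !=set0.
  move=> [P KP]; exists P => [|Q KQ]; first by case: (KP _ KP0).
  by rewrite mxdotBr subr_ge0; case: (KP _ KQ).
move: Kcompact; rewrite compact_In0 => /(_ _ K _) ; apply.
  exists halfspace => // Q _.
  apply: (@preimage_closed _ _ (mxdot (g Q)) [set x | x <= mxdot (g Q) Q]).
    by move=> P _; exact: mxdot_continuous.
  exact: closed_le.
move=> D DK; have KD Q : Q \in finmap.enum_fset D -> K Q by move=> /DK; rewrite inE.
(* Prepending [P0] makes the list nonempty, hence the simplex of weights too. *)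
pose s := P0 :: finmap.enum_fset D.
have Ks (i : 'I_(size s)) : K s`_i.
  have /predU1P[->//|] : s`_i \in s by exact: mem_nth.
  exact: KD.
(* Entries [(i, k)] and [(k, i)] add up to the pairing of [g s_i - g s_k] with [s_i - s_k], which
   monotonicity makes nonnegative. *)
have [i k|lam lamS lam_ge0] := prob_simplex_mulmx_ge0
    (\matrix_(i, k < size s) mxdot (g s`_i) (s`_i - s`_k)).
  by rewrite !mxE -(opprB s`_i s`_k) mxdotNr -mxdotBl g_monotone.
exists (\sum_i lam ord0 i *: s`_i) => Q QD; split; first exact: Kconvex.
have Qs : Q \in s by rewrite inE; apply/orP; right.
have /= := lam_ge0 (Ordinal (etrans (index_mem Q s) Qs)).
under eq_bigr do rewrite mxE /= nth_index // mxdotBr mulrBl.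
rewrite sumrB -mulr_sumr lamS.2 mulr1 subr_ge0 /halfspace /= mxdot_sumr.
by under [in X in _ -> X]eq_bigr do rewrite mxdotZr mulrC.
Qed.

(** * Stochastic matrices and changes of a single row *)

Section Stochastic.
Context {R : realType} {d : nat}.
Implicit Types (P Q : 'M[R]_d) (q : 'rV[R]_d).

(** The set is a product of [d] simplices, read as a row vector of rows and carried to matrices by
    the continuous map [flat]. *)
Lemma stochastic_mx_compact : compact (@stochastic_mx R d).
Proof.
pose flat (v : 'rV['rV[R]_d]_d) : 'M[R]_d := \matrix_(i, j) v ord0 i ord0 j.
have flat_continuous : continuous flat.
  move=> v A /nbhs_ballP[e /= e0 eA]; apply/nbhs_ballP; exists e => //= w [_ vw].
  by apply: eA; split=> // i j; rewrite !mxE; have [_] := vw ord0 i; exact.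
have -> : @stochastic_mx R d =
    flat @` [set v : 'rV['rV[R]_d]_d | forall i, @prob_simplex R d (v ord0 i)].
  apply/seteqP; split=> [P SP|_ [v Sv <-] i].
    exists (\row_i row i P) => [i /=|]; first by rewrite mxE; exact: SP.
    by apply/matrixP => i j; rewrite !mxE.
  rewrite (_ : row i _ = v ord0 i); first exact: Sv.
  by apply/rowP => j; rewrite !mxE.
apply: continuous_compact; first exact: continuous_subspaceT.
by apply: (@rV_compact _ _ (fun=> prob_simplex)) => _; exact: prob_simplex_compact.
Qed.

Lemma stochastic_mx_convex k (lam : 'rV[R]_k) (Q : 'I_k -> 'M[R]_d) :
  prob_simplex lam -> (forall i, stochastic_mx (Q i)) ->
  stochastic_mx (\sum_i lam ord0 i *: Q i).
Proof.
move=> [lam0 lam1] SQ i.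
have entry j : row i (\sum_l lam ord0 l *: Q l) ord0 j =
    \sum_l lam ord0 l * Q l i j.
  by rewrite !mxE summxE; apply: eq_bigr => l _; rewrite mxE.
split=> [j|].
  rewrite entry; apply: sumr_ge0 => l _; apply: mulr_ge0 => //.
  by have [/(_ j)] := SQ l i; rewrite mxE.
under eq_bigr do rewrite entry.
rewrite exchange_big /= -[RHS]lam1; apply: eq_bigr => l _.
rewrite -mulr_sumr -[RHS]mulr1; congr (_ * _).
by have [_ <-] := SQ l i; apply: eq_bigr => j _; rewrite mxE.
Qed.

Lemma replace_row_stochastic P q i :
  stochastic_mx P -> prob_simplex q -> stochastic_mx (replace_row P q i).
Proof.
move=> SP Sq k; rewrite (_ : row k _ = if k == i then q else row k P).
  by case: ifP => _ //; exact: SP.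
by apply/rowP => j; rewrite !mxE; case: ifP => _; rewrite ?mxE.
Qed.

Lemma replace_row_segment P q i (t : R) :
  P + t *: (replace_row P q i - P) =
  replace_row P (row i P + t *: (q - row i P)) i.
Proof.
apply/matrixP => k l; rewrite !mxE.
by case: eqP => [->|_] //; rewrite subrr mulr0 addr0.
Qed.

(** This lets the first-order conditions of the separate rows be added into one inequality for the
    whole matrix. *)
Lemma sum_replace_rowB P Q :
  Q - P = \sum_i (replace_row P (row i Q) i - P).
Proof.
apply/matrixP => k l; rewrite summxE (bigD1 k) //= big1 => [|i ik].
  by rewrite !mxE eqxx addr0.
by rewrite !mxE eq_sym (negbTE ik) subrr.
Qed.

End Stochastic.

(** * Directional derivatives *)

Section Derivatives.
Context {R : realType}.

Lemma is_derive_line {V : normedModType R} (f : V -> R) (x v : V) (t : R) :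
  derivable f (x + t *: v) v ->
  is_derive t 1 (fun s => f (x + s *: v)) ('D_v f (x + t *: v)).
Proof.
have e : (fun h => h^-1 *: (((fun s => f (x + s *: v)) \o shift t) (h *: 1)
      - f (x + t *: v))) =
    (fun h : R => h^-1 *: ((f \o shift (x + t *: v)) (h *: v)
      - f (x + t *: v))).
  apply/funext => h /=; congr (_ *: (f _ - _)).
  by rewrite [h *: 1]mulr1 scalerDl addrCA addrA.
move=> df; apply: DeriveDef; first by rewrite /derivable e.
by rewrite /derive e.
Qed.

(** The derivative is the limit from the right of difference quotients that are nonnegative for
    [0 < h <= 1]. *)
Lemma derive_ge0_of_min {V : normedModType R} (f : V -> R) (x v : V) :
  derivable f x v ->
  (forall t : R, 0 < t <= 1 -> f x <= f (x + t *: v)) -> 0 <= 'D_v f x.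
Proof.
move=> df fmin; rewrite /derive (cvg_at_rightE _ _ df).
apply: limr_ge; first by apply: cvgP; exact: (cvg_dnbhs_at_right df).
near=> h; have h0 : 0 < h by near: h; exact: nbhs_right_gt.
apply: mulr_ge0; first by rewrite invr_ge0 ltW.
rewrite subr_ge0 /= addrC; apply: fmin; rewrite h0 /=.
by near: h; exact: nbhs_right_le.
Unshelve. all: by end_near. Qed.

(** Row [i] of [own_row_gradient f] holds partial derivatives of [f i]; its other rows belong to
    other functions, but there the direction vanishes. *)
Lemma derive_own_row {d : nat} (f : 'I_d -> 'M[R]_d -> R) (P Q : 'M[R]_d) q i :
  differentiable (f i) Q ->
  'D_(replace_row P q i - P) (f i) Q =
  mxdot (own_row_gradient f Q) (replace_row P q i - P).
Proof.
move=> df; rewrite deriveE // {1}[_ - _]matrix_sum_delta !linear_sum.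
apply: eq_bigr => k _; rewrite linear_sum; apply: eq_bigr => l _.
rewrite linearZ /= [X in _ = X * _]mxE -deriveE // [RHS]mulrC.
have [-> //|/negbTE ki] := eqVneq k i.
by rewrite !mxE ki subrr scale0r mul0r.
Qed.

End Derivatives.

(** * Nash minimizers and variational inequalities *)

Section Nash.
Context {R : realType} {d : nat}.
Context {f : 'I_d -> 'M[R]_d -> R}
  (f_differentiable : forall i P, differentiable (f i) P).

(** Moving row [i] of [P] towards that of [Q] cannot decrease [f i], so each one-row derivative is
    nonnegative; these add up over the rows. *)
Lemma nash_minimizer_variational P Q :
  nash_minimizer f P -> stochastic_mx Q ->
  0 <= mxdot (own_row_gradient f P) (Q - P).
Proof.
move=> [SP Pmin] SQ; rewrite sum_replace_rowB mxdot_sumr.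
apply: sumr_ge0 => i _; rewrite -derive_own_row //.
apply: derive_ge0_of_min => [|t t01]; first exact: diff_derivable.
rewrite replace_row_segment; apply: Pmin; apply: segment_prob_simplex => //.
by case/andP: t01 => /ltW -> ->.
Qed.

Lemma nash_minimizer_of_variational P :
  stochastic_mx P ->
  (forall Q, stochastic_mx Q -> 0 <= mxdot (own_row_gradient f Q) (Q - P)) ->
  nash_minimizer f P.
Proof.
move=> SP PQ; split=> // i q Sq.
pose v := replace_row P q i - P.
have dphi (t : R) : is_derive t 1 (fun s => f i (P + s *: v))
    ('D_v (f i) (P + t *: v)).
  by apply: is_derive_line; exact: diff_derivable.
have phi_continuous : {within `[0, 1], continuous (fun s => f i (P + s *: v))}.
  apply: derivable_within_continuous => t _; exact: ex_derive.
(* The cost change is the derivative at an intermediate point [P + t *: v]; the inequality tested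
   there pairs the gradient with [t *: v], and [t > 0] cancels. *)
have [t t01] := MVT (@ltr01 R) (fun t _ => dphi t) phi_continuous.
rewrite scale1r scale0r addr0 subr0 mulr1 (addrC P v) /v subrK => e.
rewrite -subr_ge0 e derive_own_row //.
move: t01; rewrite in_itv /= => /andP[t0 t1].
suff : 0 <= mxdot (own_row_gradient f (P + t *: v)) (P + t *: v - P).
  by rewrite addrAC subrr add0r mxdotZr pmulr_rge0.
apply: PQ; rewrite replace_row_segment; apply: replace_row_stochastic => //.
by apply: segment_prob_simplex => //; rewrite !ltW.
Qed.

End Nash.

Theorem theorem2 (R : realType) (d : nat) (hd : (1 < d)%N)
    (c : 'I_d -> 'I_d -> 'rV[R]_d -> 'M[R]_d -> R)
    (e_differentiable : forall (pi V : 'rV[R]_d) (i : 'I_d) (P : 'M[R]_d),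
       prob_simplex pi ->
       differentiable (fun M : 'M[R]_d => expected_cost c i pi M V) P)
    (e_row_convex : forall (pi V : 'rV[R]_d) (P : 'M[R]_d) (i : 'I_d),
       prob_simplex pi -> stochastic_mx P ->
       convex_function prob_simplex
         (fun q : 'rV[R]_d => expected_cost c i pi (replace_row P q i) V))
    (e_continuous : forall (pi V : 'rV[R]_d) (i : 'I_d),
       prob_simplex pi ->
       continuous (fun P : 'M[R]_d => expected_cost c i pi P V))
    (e_diagonally_convex : forall pi V : 'rV[R]_d,
       prob_simplex pi ->
       diagonally_convex
         (own_row_gradient (fun i (P : 'M[R]_d) => expected_cost c i pi P V))) :
  forall pi V : 'rV[R]_d, prob_simplex pi ->
    exists! P : 'M[R]_d,
      nash_minimizer (fun i (M : 'M[R]_d) => expected_cost c i pi M V) P.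
Proof.
move=> pi V Spi.
set f := fun i (M : 'M[R]_d) => _.
pose g := own_row_gradient f.
have df i P : differentiable (f i) P by exact: e_differentiable.
have g_strict (P Q : 'M[R]_d) : P != Q -> 0 < mxdot (g P - g Q) (P - Q).
  move=> /(e_diagonally_convex pi V Spi); congr (0 < _).
  apply: eq_bigr => i _; apply: eq_bigr => j _.
  by rewrite mulrC !mxE.
have g_monotone (P Q : 'M[R]_d) : 0 <= mxdot (g P - g Q) (P - Q).
  have [->|/g_strict/ltW//] := eqVneq P Q.
  by rewrite mxdotBl subrr.
have stochastic_nonempty : @stochastic_mx R d !=set0.
  (* All rows are taken equal to [pi]. *)
  exists (\matrix_(i < d) pi) => i; rewrite rowK; exact: Spi.
have [P SP Pvar] := monotone_variational_inequality _ _
  stochastic_mx_compact stochastic_nonempty stochastic_mx_convex g_monotone.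
exists P; split=> [|Q nashQ]; first exact: nash_minimizer_of_variational.
have nashP : nash_minimizer f P by exact: nash_minimizer_of_variational.
(* Adding the first-order conditions of [P] against [Q] and of [Q] against [P] yields the reverse of
   strict monotonicity. *)
apply/eqP/negPn/negP => /g_strict; apply/negP; rewrite -leNgt.
have := nash_minimizer_variational df _ _ nashP nashQ.1.
have := nash_minimizer_variational df _ _ nashQ nashP.1.
by rewrite -/g mxdotBl -(opprB P Q) mxdotNr; lra.
Qed.
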